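(* There exists a constant $c>0$ such that for every $N=2^n$, every $M\ge 2$, and every set $S$ of $M$ distinct Boolean functions $f:\{0,1\}^n\to\{0,1\}$ (viewed as an $N\times M$ matrix), with $K=\#(S)$ the maximum number of $1$'s in a single column of the matrix, the bounded-error quantum query complexity $Q(S)$ of identifying the input oracle from $S$ satisfies $$Q(S)\ge c\,\sqrt{M/K}.$$
   Context: Let $N=2^n$. An oracle is a Boolean function $f:\{0,1\}^n\to\{0,1\}$, and inputs are identified with integers $0,\dots,N-1$ via binary representation. A set $S=\{f_0,\dots,f_{M-1}\}$ of $M$ distinct oracles is viewed as a Boolean matrix with $M$ rows (oracles) and $N$ columns (inputs), called an $N\times M$ matrix; the entry in row $i$, column $j$ is $f_i(j)$. Thus $\#(S)=\max_{0\le j\le N-1}|\{f\in S: f(j)=1\}|$. The oracle identification problem (OIP) for $S$: the set $S$ is completely known, an unknown $f\in S$ (the input oracle) is given as a black box, and the task is to determine which element of $S$ it is. A quantum algorithm with $t$ queries is a sequence $U_0,O_f,U_1,O_f,\dots,O_f,U_t$ applied to a fixed initial state (with arbitrary finite workspace), followed by a measurement producing the output, where the $U_j$ are arbitrary unitaries independent of $f$ and $O_f$ maps $|x\rangle|b\rangle$ to $(-1)^{b\cdot f(x)}|x\rangle|b\rangle$ for $x\in\{0,1\}^n$, $b\in\{0,1\}$ (identity on the rest of the workspace). It solves the OIP for $S$ with bounded error if for every $f\in S$, when run with $O_f$, it outputs (the index of) $f$ with probability at least $2/3$. $Q(S)$ is the minimum $t$ for which such an algorithm exists. *)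

(* Defs.v *)
From HB Require Import structures.
From mathcomp Require Import all_boot all_order all_algebra.
From mathcomp Require Import spectral complex.
From mathcomp Require Import all_classical all_reals all_analysis.

Set Implicit Arguments.
Unset Strict Implicit.
Unset Printing Implicit Defensive.

Import Order.TTheory GRing.Theory Num.Theory.

Local Open Scope classical_set_scope.
Local Open Scope complex_scope.
Local Open Scope sesquilinear_scope.
Local Open Scope ring_scope.

(* The bit strings index the N = 2 ^ n columns directly, without passing       *)
(* through their values as integers.                                           *)
Definition input (n : nat) : finType := n.-tuple bool.
Definition oracle (n : nat) : finType := {ffun input n -> bool}.

(* #(S) *)
Definition max_column_ones n (S : {set oracle n}) : nat :=
  \max_(x : input n) #|[set f in S | f x]%SET|.

Section QuantumAlgorithm.
Variables (R : realType) (n : nat).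

(* The basis states |x>|b>|w>; matrices and vectors are indexed by their ranks *)
(* in the enumeration of this type.                                            *)
Definition register_basis (W : finType) : finType := (input n * bool * W)%type.

Definition oracle_mx (W : finType) (f : oracle n) : 'M[R[i]]_#|register_basis W| :=
  diag_mx (\row_k let: (x, b, _) := enum_val k in (-1) ^+ (b && f x)).

Definition sqnorm d (v : 'cV[R[i]]_d) : R[i] := \sum_k `|v k 0| ^+ 2.

(* The final measurement is an arbitrary quantum measurement with outcomes in  *)
(* [oracle n], given by operators E_g such that \sum_g E_g^* E_g = 1; outcome  *)
(* g has probability |E_g psi|^2 in the state psi.  Restricting the outcomes   *)
(* to functions loses nothing, since any other output would be a wrong answer. *)
Record quantum_algorithm (t : nat) := QuantumAlgorithm {
  workspace : finType;
  init : 'cV[R[i]]_#|register_basis workspace|;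
  gate : nat -> 'M[R[i]]_#|register_basis workspace|;
  meas : oracle n -> 'M[R[i]]_#|register_basis workspace|;
  init_unit : sqnorm init = 1;
  gate_unitary : forall j, (j <= t)%N -> gate j \is unitarymx;
  meas_complete : \sum_g (meas g)^t* *m meas g = 1%:M }.

(* The state after j queries and the gates U_0, ..., U_j. *)
Fixpoint run t (A : quantum_algorithm t) (f : oracle n) (j : nat)
    : 'cV[R[i]]_#|register_basis (workspace A)| :=
  if j is j'.+1 then gate A j *m (oracle_mx (workspace A) f *m run A f j')
  else gate A 0 *m init A.

Definition output_prob t (A : quantum_algorithm t) (f g : oracle n) : R[i] :=
  sqnorm (meas A g *m run A f t).

Definition solves_OIP t (A : quantum_algorithm t) (S : {set oracle n}) : Prop :=
  forall f, f \in S -> 2 / 3 <= output_prob A f f.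

(* The infimum of a nonempty set of natural numbers is its minimum; the set is *)
(* never empty, as 2 ^ n queries determine f.                                  *)
Definition query_complexity (S : {set oracle n}) : \bar R :=
  ereal_inf [set t%:R%:E | t in
    [set t : nat | exists A : quantum_algorithm t, solves_OIP A S]].

End QuantumAlgorithm.

(* Main.v *)
Require Import Defs.
From mathcomp Require Import all_boot all_order all_algebra.
From mathcomp Require Import spectral complex zify ring.
From mathcomp Require Import all_classical all_reals all_analysis.

(** The hybrid argument of Bennett, Bernstein, Brassard and Vazirani against the
    all-zero oracle.  One query to [f] instead of the zero oracle changes a unit
    state by at most twice the norm of its component on the basis states
    [|x>|1>|w>] with [f x = 1]; since each [x] is hit by at most [K] elements of
    [S], these squared changes sum to at most [4K] over [S], and after [t]
    queries to at most [4 t^2 K].  On the other hand the outcome probabilities in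
    the fixed final state for the zero oracle sum to 1, so an algorithm that
    identifies all [M] oracles must have total squared deviation of order [M]. *)

Set Implicit Arguments.
Unset Strict Implicit.
Unset Printing Implicit Defensive.

Import Order.TTheory GRing.Theory Num.Theory.

Local Open Scope complex_scope.
Local Open Scope sesquilinear_scope.
Local Open Scope ring_scope.

(** After the triangle inequality, the gap between the two sides is the square
    [(e * |x| - |y|) ^ 2 / e]. The weight [e] stays free because the induction over queries and the
    final estimate need different values. *)
Lemma normC_sqrD_le (C : numClosedFieldType) (e x y : C) : 0 < e ->
  `|x + y| ^+ 2 <= (1 + e) * `|x| ^+ 2 + (1 + e^-1) * `|y| ^+ 2.
Proof.
move=> e0; apply: (@le_trans _ _ ((`|x| + `|y|) ^+ 2)).
  by rewrite lerXn2r ?nnegrE ?addr_ge0 // ler_normD.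
rewrite -subr_ge0.
have -> : (1 + e) * `|x| ^+ 2 + (1 + e^-1) * `|y| ^+ 2 - (`|x| + `|y|) ^+ 2 =
    (e * `|x| - `|y|) ^+ 2 / e by field; rewrite gt_eqF.
rewrite divr_ge0 ?(ltW e0) // real_exprn_even_ge0 //.
by rewrite rpredB // ?rpredM ?normr_real // gtr0_real.
Qed.

Section SquaredNorm.
Variable R : realType.

Lemma sqnormE d (v : 'cV[R[i]]_d) : sqnorm v = (v^t* *m v) 0 0.
Proof. by rewrite mxE; apply: eq_bigr => k _; rewrite !mxE mulrC normCK. Qed.

Lemma sqnorm_ge0 d (v : 'cV[R[i]]_d) : 0 <= sqnorm v.
Proof. by apply: sumr_ge0 => k _; rewrite exprn_ge0. Qed.

Lemma sqnorm0 d : sqnorm (0 : 'cV[R[i]]_d) = 0.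
Proof. by apply: big1 => k _; rewrite mxE normr0 expr0n. Qed.

Lemma sqnorm_unitary d (U : 'M[R[i]]_d) (v : 'cV[R[i]]_d) :
  U \is unitarymx -> sqnorm (U *m v) = sqnorm v.
Proof.
move=> /unitarymxP/mulmx1C UU; rewrite !sqnormE trmx_mul map_mxM /=.
by rewrite -mulmxA (mulmxA _ U) UU mul1mx.
Qed.

Lemma sqnormD_le d (e : R[i]) (u v : 'cV[R[i]]_d) : 0 < e ->
  sqnorm (u + v) <= (1 + e) * sqnorm u + (1 + e^-1) * sqnorm v.
Proof.
move=> e0; rewrite /sqnorm !mulr_sumr -big_split /=.
by apply: ler_sum => k _; rewrite mxE normC_sqrD_le.
Qed.

Lemma sum_sqnorm_complete (I : finType) d (E : I -> 'M[R[i]]_d)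
    (v : 'cV[R[i]]_d) :
  \sum_i (E i)^t* *m E i = 1%:M -> \sum_i sqnorm (E i *m v) = sqnorm v.
Proof.
move=> E1; rewrite sqnormE -[X in _ *m X](mul1mx v) -E1.
rewrite mulmx_suml mulmx_sumr summxE.
apply: eq_bigr => i _.
by rewrite sqnormE trmx_mul map_mxM -(mulmxA (v^t*)) (mulmxA _ (E i) v).
Qed.

(** One term of a sum of nonnegative terms is at most the whole. This carries a bound on the
    deviation of states over to a single measurement outcome. *)
Lemma sqnorm_complete_le (I : finType) d (E : I -> 'M[R[i]]_d)
    (v : 'cV[R[i]]_d) i :
  \sum_i (E i)^t* *m E i = 1%:M -> sqnorm (E i *m v) <= sqnorm v.
Proof.
move=> E1; rewrite -[leRHS](sum_sqnorm_complete v E1) (bigD1 i) //= lerDl.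
by apply: sumr_ge0 => j _; exact: sqnorm_ge0.
Qed.

End SquaredNorm.

Section Hybrid.
Variables (R : realType) (n : nat).

Definition zero_oracle : oracle n := [ffun=> false].

Lemma oracle_mx_zero (W : finType) : oracle_mx R W zero_oracle = 1%:M.
Proof.
apply/matrixP => i j; rewrite !mxE; case: (enum_val i) => [[x b] w].
by rewrite /zero_oracle ffunE andbF expr0.
Qed.

Lemma sqnorm_oracle_mx (W : finType) (f : oracle n)
    (v : 'cV[R[i]]_#|register_basis n W|) :
  sqnorm (oracle_mx R W f *m v) = sqnorm v.
Proof.
apply: eq_bigr => k _; rewrite mul_diag_mx !mxE.
by case: (enum_val k) => [[x b] w]; rewrite normrM normrX normrN1 expr1n mul1r.
Qed.

Lemma sum_query_deviation_le (W : finType) (S : {set oracle n})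
    (v : 'cV[R[i]]_#|register_basis n W|) :
  \sum_(f in S) sqnorm (oracle_mx R W f *m v - v)
    <= 4 * (max_column_ones S)%:R * sqnorm v.
Proof.
rewrite /sqnorm exchange_big /= mulr_sumr; apply: ler_sum => k _.
case kE : (enum_val k) => [[x b] w].
(* A diagonal entry minus 1 is [-2] if both [b] and [f x] hold and [0] otherwise; the factor 4 is
   the square of that 2. *)
apply: (@le_trans _ _ (\sum_(f in S) 4 * (f x)%:R * `|v k 0| ^+ 2)).
  apply: ler_sum => f _; rewrite mul_diag_mx !mxE kE.
  have -> y : (-1) ^+ (b && f x) * y - y = ((-1) ^+ (b && f x) - 1) * y :> R[i].
    by rewrite mulrBl mul1r.
  rewrite normrM exprMn ler_wpM2r ?exprn_ge0 //.
  case: b {kE} (f x) => [] [] /=.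
  - by rewrite expr1 -opprD normrN (_ : 1 + 1 = 2%:R) // normr_nat -natrX mulr1.
  - by rewrite expr0 subrr normr0 expr0n mulr0.
  - by rewrite expr0 subrr normr0 expr0n mulr1.
  - by rewrite expr0 subrr normr0 expr0n mulr0.
rewrite -mulr_suml -mulr_sumr ler_wpM2r ?exprn_ge0 // ler_wpM2l // -natr_sum.
rewrite ler_nat (leq_trans _ (leq_bigmax x)) //.
rewrite -sum1dep_card big_mkcondr /=.
by apply: leq_sum => f _; case: (f x).
Qed.

Variables (t : nat) (A : quantum_algorithm R n t).

Lemma sqnorm_run f j : (j <= t)%N -> sqnorm (run A f j) = 1.
Proof.
elim: j => [|j IH] jt /=.
  by rewrite sqnorm_unitary ?init_unit ?gate_unitary.
by rewrite sqnorm_unitary ?gate_unitary // sqnorm_oracle_mx IH // ltnW.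
Qed.

Lemma sum_run_deviation_le (S : {set oracle n}) j : (j <= t)%N ->
  \sum_(f in S) sqnorm (run A f j - run A zero_oracle j)
    <= 4 * (max_column_ones S)%:R * j%:R ^+ 2.
Proof.
set K : R[i] := (max_column_ones S)%:R.
elim: j => [|j IH] jt.
  by rewrite big1 ?expr0n ?mulr0 //= => f _; rewrite subrr sqnorm0.
pose d f := run A f j - run A zero_oracle j.
(* The new query is charged to the state of the zero-oracle run, which is the same for all [f], so
   that the summed bound for one query applies. The old deviation [d f] only passes through
   norm-preserving maps. *)
pose q f := oracle_mx R (workspace A) f *m run A zero_oracle j
            - run A zero_oracle j.
have runB f : sqnorm (run A f j.+1 - run A zero_oracle j.+1) =
    sqnorm (oracle_mx R (workspace A) f *m d f + q f).
  rewrite /= -mulmxBr sqnorm_unitary ?gate_unitary // oracle_mx_zero mul1mx.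
  by rewrite /d /q mulmxBr addrA subrK.
have q_le : \sum_(f in S) sqnorm (q f) <= 4 * K.
  apply: le_trans (sum_query_deviation_le S (run A zero_oracle j)) _.
  by rewrite sqnorm_run ?mulr1 // ltnW.
under eq_bigr do rewrite runB.
(* The first query is separate: the weight used below is the inverse of the number of earlier
   queries, and here the old deviation is zero. *)
case: j => [|j] in IH jt d q runB q_le *.
  under eq_bigr do rewrite /d subrr mulmx0 add0r.
  by rewrite expr1n mulr1.
have e0 : 0 < j.+1%:R^-1 :> R[i] by rewrite invr_gt0 ltr0n.
(* The weight [e = 1/j] is the one for which the bound [4 K j^2] is reproduced
   exactly at the next step. *)
apply: (@le_trans _ _ (\sum_(f in S) ((1 + j.+1%:R^-1) * sqnorm (d f)
                         + (1 + j.+1%:R) * sqnorm (q f)))).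
  apply: ler_sum => f _; apply: le_trans (sqnormD_le _ _ e0) _.
  by rewrite invrK sqnorm_oracle_mx.
rewrite big_split /= -!mulr_sumr.
apply: (@le_trans _ _ ((1 + j.+1%:R^-1) * (4 * K * j.+1%:R ^+ 2)
                       + (1 + j.+1%:R) * (4 * K))).
  rewrite lerD // ler_wpM2l ?addr_ge0 ?(ltW e0) //.
  exact: IH (ltnW jt).
rewrite (natrD _ 1 j.+1) le_eqVlt; apply/orP; left; apply/eqP.
have : j.+1%:R != 0 :> R[i] by rewrite pnatr_eq0.
by move: j.+1%:R => x x0; field.
Qed.

Lemma solves_OIP_card_le (S : {set oracle n}) : (2 <= #|S|)%N ->
  solves_OIP A S -> (#|S| <= 336 * (max_column_ones S * t ^ 2))%N.
Proof.
move=> M2 solA.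
set z := run A zero_oracle t; set K := max_column_ones S.
(* Any weight below [1/3] would do: the constant term [1 + e] must stay below [2/3 * #|S|], which is
   at least [4/3]. *)
have e0 : 0 < 6^-1 :> R[i] by rewrite invr_gt0.
have z_le : \sum_(f in S) sqnorm (meas A f *m z) <= 1.
  rewrite -(sqnorm_run zero_oracle (leqnn t)).
  rewrite -[leRHS](sum_sqnorm_complete _ (meas_complete A)) [leRHS](bigID (mem S)) /= lerDl.
  by apply: sumr_ge0 => f _; exact: sqnorm_ge0.
have M_le : 2 / 3 * #|S|%:R <=
    (1 + 6^-1) + (1 + 6) * (4 * K%:R * t%:R ^+ 2) :> R[i].
  apply: (@le_trans _ _ (\sum_(f in S) ((1 + 6^-1) * sqnorm (meas A f *m z)
                          + (1 + 6) * sqnorm (run A f t - z)))).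
    rewrite mulr_natr -sumr_const.
    apply: ler_sum => f fS; apply: le_trans (solA f fS) _.
    have -> : output_prob A f f =
        sqnorm (meas A f *m z + meas A f *m (run A f t - z)).
      by rewrite -mulmxDr addrC subrK.
    apply: le_trans (sqnormD_le _ _ e0) _.
    rewrite invrK lerD2l ler_wpM2l //.
    exact: sqnorm_complete_le (meas_complete A).
  rewrite big_split /= -!mulr_sumr lerD //.
    by rewrite -[leRHS]mulr1 ler_wpM2l // addr_ge0 ?(ltW e0).
  by rewrite ler_wpM2l //; exact: sum_run_deviation_le.
have {}M_le : (4 * #|S| <= 7 + 168 * (K * t ^ 2))%N.
  rewrite -(ler_nat R[i]) natrD (natrM _ 4) (natrM _ 168) (natrM _ K) natrX.
  have -> : 4%:R * #|S|%:R = 6 * (2 / 3 * #|S|%:R) :> R[i] by field.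
  have -> : 7%:R + 168%:R * (K%:R * t%:R ^+ 2) =
    6 * (1 + 6^-1 + (1 + 6) * (4 * K%:R * t%:R ^+ 2)) :> R[i] by field.
  by rewrite ler_wpM2l.
(* For [M >= 2], [4 * M - 7] is at least [M / 2], so [M <= 2 * 168 * Q]. *)
move: M2 M_le; move: #|S| (K * t ^ 2)%N => M Q; lia.
Qed.

End Hybrid.

Theorem theorem4 (R : realType) :
  exists c : R, 0 < c /\
    forall (n M : nat) (S : {set oracle n}),
      (2 <= M)%N -> #|S| = M ->
      ((c * Num.sqrt (M%:R / (max_column_ones S)%:R))%:E
        <= query_complexity R S)%E.
Proof.
(* The constant is chosen so that [20 ^ 2 = 400] exceeds 336. *)
exists 20^-1; split; first by rewrite invr_gt0.
move=> n M S M2 cardS; apply: le_ereal_inf_tmp => _ [t [A solA] <-].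
rewrite lee_fin ler_pdivrMl //.
have := @solves_OIP_card_le R n t A S; rewrite cardS => /(_ M2 solA).
set K := max_column_ones S => M_le.
(* With [K = 0] the bound would force [M = 0]; hence the quotient [M / K] is a genuine one. *)
have K0 : (0 < K)%N by case: K M_le; lia.
rewrite -(ler_sqr (sqrtr_ge0 _)) ?nnegrE ?mulr_ge0 //.
rewrite sqr_sqrtr ?divr_ge0 // ler_pdivrMr ?ltr0n //.
rewrite exprMn -!natrX -!natrM ler_nat.
by apply: leq_trans M_le _; lia.
Qed.
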